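(* For all $n\ge 1$, let $f_0(n)$ be the number of permutations $\pi$ of $[n]$ such that $\pi(i-1)+\pi(i+1)-2\pi(i)\le 0$ for all $i\in\{2,3,\ldots,n-1\}$. Then $$f_0(n)=\begin{cases}1 & \text{if } n=1\\ 2 & \text{if } n=2\\ 4 & \text{if } n=3\\ 6 & \text{if } n=4\\ 8 & \text{if } n\ge 5.\end{cases}$$
   Context: $[n]=\{1,2,\ldots,n\}$; a permutation of length $n$ is a bijection $\pi:[n]\to[n]$. The condition is vacuous for $n\le 2$. *)

(* Defs.v *)
From mathcomp Require Import all_boot all_order all_algebra all_fingroup.

Set Implicit Arguments.
Unset Strict Implicit.
Unset Printing Implicit Defensive.

Import GRing.Theory Num.Theory.

Local Open Scope ring_scope.

(* The ordinal j : 'I_n stands for the element j + 1 of [n] = {1, ..., n}, both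
   as an argument and as a value of the permutation. *)
Definition perm_val (n : nat) (s : 'S_n) (j : 'I_n) : int := ((s j).+1)%:Z.

(* l, i, r range over all triples of consecutive positions, so i ranges over
   the interior positions 2, ..., n - 1 of [n]. *)
Definition second_diffs_le0 (n : nat) (s : 'S_n) : bool :=
  [forall l : 'I_n, forall i : 'I_n, forall r : 'I_n,
    (i == l.+1 :> nat) && (r == i.+1 :> nat) ==>
      (perm_val s l + perm_val s r - 2 * perm_val s i <= 0)].

Definition f0 (n : nat) : nat := #|[set s : 'S_n | second_diffs_le0 s]|.

(* Main.v *)
Require Import Defs.
From mathcomp Require Import all_boot all_order all_algebra all_fingroup.
From mathcomp Require Import zify.

Set Implicit Arguments.
Unset Strict Implicit.
Unset Printing Implicit Defensive.

(** Count values from 0.  A concave arrangement has no interior local minimum,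
    so 0 sits at an end, by symmetry at the left one.  For the same reason each
    of 1, 2, 3 in turn sits next to the values already placed, at one end or the
    other.  The resulting end slopes bound a concave sequence from above, and in
    each of the four cases the upper bound is itself a permutation.  As a
    permutation bounded pointwise by another one is equal to it, these four
    permutations and their reversals are the only candidates. *)

(* The four words 0 1 2 .. n-1,  0 n-1 .. 2 1,  0 2 3 .. n-1 1  and
   0 2 4 .. 5 3 1. *)
Definition extremal (n k j : nat) : nat :=
  match k with
  | 0 => j
  | 1 => if j == 0 then 0 else n - j
  | 2 => if j == 0 then 0 else if j == n.-1 then 1 else j.+1
  | _ => if j.*2 < n then j.*2 else (n.-1 - j).*2.+1
  end.

Definition signed_extremal (n : nat) (c : bool * nat) (j : nat) : nat :=
  extremal n c.2 (if c.1 then n.-1 - j else j).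

(** Stated with addition and doubling because subtraction in [nat] truncates. *)
Definition concave (n : nat) (p : nat -> nat) : Prop :=
  forall i, i.+2 < n -> p i + p i.+2 <= (p i.+1).*2.

Lemma signed_extremal_lt n c j : j < n -> signed_extremal n c j < n.
Proof.
by case: c => [[] [|[|[|k]]]]; rewrite /signed_extremal /extremal /=;
  repeat case: ifP; lia.
Qed.

Lemma signed_extremal_inj n c i j : i < n -> j < n ->
  signed_extremal n c i = signed_extremal n c j -> i = j.
Proof.
by case: c => [[] [|[|[|k]]]]; rewrite /signed_extremal /extremal /=;
  repeat case: ifP; lia.
Qed.

Lemma signed_extremal_concave n c : concave n (signed_extremal n c).
Proof.
by case: c => [[] [|[|[|k]]]] i; rewrite /signed_extremal /extremal /=;
  repeat case: ifP; lia.
Qed.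

Lemma concave_rev n p : concave n p -> concave n (fun j => p (n.-1 - j)).
Proof.
move=> cp i lin; have := cp (n.-1 - i.+2).
have -> : (n.-1 - i.+2).+2 = n.-1 - i by lia.
have -> : (n.-1 - i.+2).+1 = n.-1 - i.+1 by lia.
lia.
Qed.

(** Differences of a concave sequence never increase, so a bound [d] on one of them bounds all later
    ones. *)
Lemma concave_slope n p d i k : concave n p -> p i.+1 <= p i + d ->
  i + k < n -> p (i + k) <= p i + k * d.
Proof.
move=> cp pid.
have step m : i + m.+1 < n -> p (i + m.+1) <= p (i + m) + d.
  elim: m => [|m IHm] lmn; first by rewrite addn1 addn0.
  by have := cp (i + m); move: (IHm); rewrite !addnS; lia.
elim: k => [|k IHk] lkn; first by rewrite addn0 mul0n addn0.
by have := step k lkn; move: (IHk); rewrite mulSn !addnS; lia.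
Qed.

Lemma concave_slope_last n p d i k : concave n p -> 0 < i -> i < n ->
  p i.-1 <= p i + d -> k <= i -> p (i - k) <= p i + k * d.
Proof.
move=> cp i_gt0 lin pid lki.
have := @concave_slope n _ d (n.-1 - i) k (concave_rev cp) _ _.
have -> : n.-1 - (n.-1 - i).+1 = i.-1 by lia.
have -> : n.-1 - (n.-1 - i) = i by lia.
have -> : n.-1 - (n.-1 - i + k) = i - k by lia.
by apply=> //; lia.
Qed.

(** A strict minimum inside the window would lie below both its neighbours, against concavity. The
    window will consist of the positions not yet taken by smaller values. *)
Lemma concave_min_end n p a b q : concave n p -> b < n -> a <= q <= b ->
  (forall j, a <= j <= b -> j != q -> p q < p j) -> q = a \/ q = b.
Proof.
move=> cp lbn laqb minq.
have [-> | neqa] := eqVneq q a; first by left.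
have [-> | neqb] := eqVneq q b; first by right.
case: q => [|q] in laqb minq neqa neqb *; first by lia.
have := cp q ltac:(lia).
have := minq q ltac:(lia) ltac:(lia).
have := minq q.+2 ltac:(lia) ltac:(lia).
lia.
Qed.

(** The positions [q1], [q2], [q3] of the values 1, 2, 3 are located in turn; a branch stops once
    the end slopes found yield one of the four bounds. *)
Lemma concave_le_extremal n p : concave n p ->
  (forall i j, i < n -> j < n -> p i = p j -> i = j) ->
  (forall v, v < n -> exists2 i, i < n & p i = v) ->
  p 0 = 0 ->
  exists2 k, k < 4 & forall j, j < n -> p j <= extremal n k j.
Proof.
move=> cp injp surjp p0.
have neqp i j : i < n -> j < n -> i != j -> p i != p j.
  by move=> lin ljn; apply: contra_neq; apply: injp.
have [n_le1 | n_gt1] := leqP n 1.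
  by exists 0 => // j ljn; rewrite (_ : j = 0) ?p0 //; lia.
have [q1 lq1 p_q1] := surjp 1 n_gt1.
have q1_gt0 : 0 < q1 by case: (q1) p_q1 => //; rewrite p0.
have [|||Dq1|Dq1] := @concave_min_end n p 1 n.-1 q1 cp; try lia.
- by move=> j lj neqj; have := neqp 0 j; have := neqp q1 j; lia.
- exists 0 => // j ljn; have := @concave_slope n p 1 0 j cp.
  by move: p_q1; rewrite Dq1 add0n p0 /extremal => ->; lia.
(* At length 2 there is no value 2 to locate, and [q1] is the only position besides 0. *)
have [n_le2 | n_gt2] := leqP n 2.
  exists 0 => // j ljn; have [->|->] : j = 0 \/ j = q1 by lia.
    by rewrite p0.
  by rewrite p_q1 /=.
have [q2 lq2 p_q2] := surjp 2 n_gt2.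
have q2_gt0 : 0 < q2 by case: (q2) p_q2 => //; rewrite p0.
have neq_q21 : q2 != q1 by apply: contra_eq_neq p_q2 => ->; rewrite p_q1.
have Dq2 : q2 = 1 \/ q2 = n.-2.
  apply: concave_min_end cp _ _ _; try lia.
  move=> j lj neqj; have := neqp 0 j; have := neqp q1 j; have := neqp q2 j.
  by lia.
(* For [n = 3] the two ends 1 and [n.-2] coincide. Testing [n.-2] first settles that length here, so
   that the value 3 exists afterwards. *)
have [q2_last | q2_mid] := eqVneq q2 n.-2.
  exists 1 => // j ljn; rewrite /extremal; case: eqP => [->|/eqP j_neq0].
    by rewrite p0.
  have := @concave_slope_last n p 1 n.-1 (n.-1 - j) cp.
  have -> : n.-1 - (n.-1 - j) = j by lia.
  by rewrite -Dq1 p_q1 (_ : q1.-1 = q2) ?p_q2; lia.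
have {Dq2 q2_mid}[Dq2 n_gt3] : q2 = 1 /\ 3 < n by lia.
have [q3 lq3 p_q3] := surjp 3 n_gt3.
have q3_gt0 : 0 < q3 by case: (q3) p_q3 => //; rewrite p0.
have neq_q31 : q3 != q1 by apply: contra_eq_neq p_q3 => ->; rewrite p_q1.
have neq_q32 : q3 != q2 by apply: contra_eq_neq p_q3 => ->; rewrite p_q2.
have [|||Dq3|Dq3] := @concave_min_end n p 2 n.-2 q3 cp; try lia.
- move=> j lj neqj; have := neqp 0 j; have := neqp q1 j.
  by have := neqp q2 j; have := neqp q3 j; lia.
- exists 2 => // j ljn; rewrite /extremal; case: eqP => [->|/eqP j_neq0].
    by rewrite p0.
  case: eqP => [->|/eqP j_neqn]; first by rewrite -Dq1 p_q1.
  have := @concave_slope n p 1 1 j.-1 cp.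
  rewrite add1n prednK; last by lia.
  by move: p_q2 p_q3; rewrite Dq2 Dq3 => -> ->; lia.
(* The bound is the minimum of a line of slope 2 from the left end and one of slope -2 from the
   right end; [j.*2 < n] tells which is lower. *)
- exists 3 => // j ljn; rewrite /extremal; case: ifP => ltjn.
    have := @concave_slope n p 2 0 j cp.
    by move: p_q2; rewrite Dq2 add0n p0 => ->; lia.
  have := @concave_slope_last n p 2 n.-1 (n.-1 - j) cp.
  have -> : n.-1 - (n.-1 - j) = j by lia.
  by rewrite -Dq1 p_q1 (_ : q1.-1 = q3) ?p_q3; lia.
Qed.

(** Both permutations have the same sum of values, so no termwise inequality can be strict. *)
Lemma perm_le_eq n (s t : 'S_n) : (forall j, s j <= t j) -> s = t.
Proof.
move=> le_st; apply/permP => j; apply/val_inj/eqP.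
have sum_perm (u : 'S_n) : \sum_(i < n) (u i : nat) = \sum_(i < n) i.
  by rewrite [RHS](reindex_inj (@perm_inj _ u)).
have /leqif_sum[_] : forall i : 'I_n, true ->
    (s i : nat) <= t i ?= iff (s i == t i :> nat).
  by move=> i _; apply/leqifP; case: eqP => // /eqP; have := le_st i; lia.
by rewrite !sum_perm eqxx => /esym/forallP/(_ j).
Qed.

Definition extremal_ord n c (j : 'I_n) : 'I_n :=
  Ordinal (signed_extremal_lt c (ltn_ord j)).

Lemma extremal_ord_inj n c : injective (@extremal_ord n c).
Proof.
by move=> i j [] /signed_extremal_inj-/(_ (ltn_ord i) (ltn_ord j))/val_inj.
Qed.

Definition extremal_perm n c : 'S_n := perm (@extremal_ord_inj n c).

Lemma extremal_permE n c j :
  extremal_perm n c j = signed_extremal n c j :> nat.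
Proof. by rewrite permE. Qed.

Definition codes : seq (bool * nat) :=
  [seq (b, k) | b <- [:: false; true], k <- iota 0 4].

Lemma second_diffs_le0P n (s : 'S_n.+1) :
  reflect (concave n.+1 (fun j => s (inord j))) (second_diffs_le0 s).
Proof.
apply: (iffP forallP) => [cs i lin | cs l].
  have /forallP/(_ (inord i.+1))/forallP/(_ (inord i.+2)) := cs (inord i).
  by rewrite /perm_val !inordK ?eqxx /=; lia.
apply/forallP=> i; apply/forallP=> r; apply/implyP=> /andP[/eqP Di /eqP Dr].
have := cs l; rewrite -Di -Dr !inord_val /perm_val.
by have := ltn_ord r; lia.
Qed.

Lemma second_diffs_le0_extremal n (s : 'S_n.+1) :
  second_diffs_le0 s = (s \in [seq extremal_perm n.+1 c | c <- codes]).
Proof.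
apply/second_diffs_le0P/mapP => [cs | [c _ ->] i lin]; last first.
  by rewrite !extremal_permE !inordK ?signed_extremal_concave //; lia.
have surjs v : v < n.+1 -> exists2 i, i < n.+1 & s (inord i) = v :> nat.
  move=> lvn; exists ((s^-1)%g (inord v)) => //.
  by rewrite inord_val permKV inordK.
have injs i j : i < n.+1 -> j < n.+1 ->
    s (inord i) = s (inord j) :> nat -> i = j.
  move=> lin ljn /val_inj/perm_inj/(congr1 (@nat_of_ord _)).
  by rewrite !inordK.
have [q lqn s_q] := surjs 0 isT.
have [|||Dq|Dq] := @concave_min_end _ _ 0 n q cs; try lia.
- move=> j lj /eqP; rewrite s_q lt0n; apply: contra_not_neq => sj0.
  by apply: injs; rewrite ?sj0; lia.
- rewrite {q}Dq in lqn s_q.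
  have [k lk4 lesk] := concave_le_extremal cs injs surjs s_q.
  exists (false, k); first by rewrite allpairs_f // mem_iota.
  apply: perm_le_eq => j; rewrite extremal_permE.
  by have := lesk j (ltn_ord j); rewrite inord_val.
(* With 0 at the right end, the previous case applies to the reversed sequence. *)
- rewrite {q}Dq in lqn s_q.
  have [|||k lk4 lesk] := concave_le_extremal (concave_rev cs).
  + by move=> i j lin ljn /injs; lia.
  + move=> v /surjs[i lin <-]; exists (n - i); first by lia.
    by congr (val (s (inord _))); lia.
  + by rewrite /= subn0.
  exists (true, k); first by rewrite allpairs_f ?mem_iota.
  apply: perm_le_eq => j; rewrite extremal_permE.
  have ljn := ltn_ord j; have := lesk (n - j).
  rewrite /= subKn ?inord_val; last by lia.
  by apply; lia.
Qed.

Definition extremal_words n : seq (seq nat) :=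
  [seq mkseq (signed_extremal n c) n | c <- codes].

(** Passing from permutations to words of numbers makes the count computable at a fixed length;
    [undup] absorbs the codes that coincide at small lengths. *)
Lemma f0_extremal n : f0 n.+1 = size (undup (extremal_words n.+1)).
Proof.
pose word (s : 'S_n.+1) := mkseq (fun j => s (inord j) : nat) n.+1.
have word_inj : injective word.
  move=> s t eq_st; apply/permP=> j; apply/val_inj.
  have := congr1 (fun w => nth 0 w j) eq_st.
  by rewrite !nth_mkseq // inord_val.
have -> : extremal_words n.+1 =
    map word [seq extremal_perm n.+1 c | c <- codes].
  rewrite -map_comp; apply: eq_map => c; apply/eq_in_map => j.
  by rewrite mem_iota => ltjn; rewrite extremal_permE inordK.
rewrite undup_map_inj // size_map /f0 cardsE.
move: (@second_diffs_le0_extremal n).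
move: [seq _ | c <- codes] => perms mem_perms.
have /card_uniqP <- := undup_uniq perms.
by apply: eq_card => s; rewrite mem_undup -mem_perms.
Qed.

(** From length 5 on, the first three letters already tell the eight words apart. *)
Lemma uniq_extremal_words n : uniq (extremal_words n.+4.+1).
Proof.
apply: (@map_uniq _ _ (fun w => [:: nth 0 w 0; nth 0 w 1; nth 0 w 2])).
rewrite /extremal_words -map_comp /comp /codes /=.
(* The third letter of this word depends on whether n = 0, but is not needed. *)
pose x := signed_extremal n.+4.+1 (true, 3) 2.
have -> : signed_extremal n.+4.+1 (true, 3) 0 = 1.
  by rewrite /signed_extremal /extremal /= ifF; lia.
have -> : signed_extremal n.+4.+1 (true, 3) 1 = 3.
  by rewrite /signed_extremal /extremal /= ifF; lia.
rewrite -/x /signed_extremal /extremal /= eqxx !subSS !subn0.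
have -> : n.+1 - n = 1 by lia.
have -> : n.+2 - n = 2 by lia.
have -> : n.+3 - n = 3 by lia.
have -> : n.+3 == n.+4 = false by lia.
have -> : n.+2 == n.+4 = false by lia.
by [].
Qed.

Theorem theorem3p7 (n : nat) (hn : (1 <= n)%N) :
  f0 n = if n == 1%N then 1%N
         else if n == 2%N then 2%N
         else if n == 3%N then 4%N
         else if n == 4%N then 6%N
         else 8%N.
Proof.
case: n hn => [|n] // _; rewrite f0_extremal.
(* Lengths 1 to 4 are settled by evaluation. *)
case: n => [|[|[|[|n]]]]; try by [].
by rewrite undup_id ?uniq_extremal_words.
Qed.
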